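(* Let $d\ge1$, $\sigma_1>0$, $\beta>3$, and $p_+\in(0,1)$ with $p_-:=1-p_+\ge\frac12$. Let $(X,Y)$ be distributed as follows: $\mathbb P(Y=+1)=p_+$, $\mathbb P(Y=-1)=p_-$, $X\mid Y=+1\sim\mathcal N(0,\sigma_1^2\mathbf I_d)$ and $X\mid Y=-1\sim\mathcal N(0,\beta\sigma_1^2\mathbf I_d)$. Let $\Phi$ be the CDF of $\mathcal N(0,1)$. For any $\theta\in\mathbb R^d\setminus\{0\}$ and $b>0$, the linear classifier $f(x)=\mathrm{sign}(\langle\theta,x\rangle+b)$ has error probability $$\mathrm{err}_f:=\mathbb P\big(f(X)\neq Y\big)=p_+\Phi\Big(-\frac{b}{\|\theta\|_2\sigma_1}\Big)+p_-\Phi\Big(\frac{b}{\|\theta\|_2\sqrt\beta\,\sigma_1}\Big)\ge\frac14.$$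
   Context: $\mathbf I_d$ is the $d\times d$ identity matrix. The event $\langle\theta,X\rangle+b=0$ has probability zero, so the convention for $\mathrm{sign}(0)$ is immaterial. *)

(* Defs.v *)
From HB Require Import structures.
From mathcomp Require Import all_boot all_order all_algebra.
From mathcomp Require Import all_classical all_reals all_analysis.
Set Implicit Arguments. Unset Strict Implicit. Unset Printing Implicit Defensive.
Import Order.TTheory GRing.Theory Num.Theory.
Local Open Scope classical_set_scope.
Local Open Scope ring_scope.

(* CDF of the standard normal distribution N(0,1).
   [normal_prob m s] is the normal law with mean m and standard deviation s. *)
Definition Phi {R : realType} (x : R) : R :=
  fine (normal_prob (0:R) 1 `]-oo, x]).

Definition inner {R : realType} {n : nat} (u v : 'I_n -> R) : R :=
  \sum_(i < n) u i * v i.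
Definition norm2 {R : realType} {n : nat} (u : 'I_n -> R) : R :=
  Num.sqrt (\sum_(i < n) u i ^+ 2).

(* Conditional on [Y = y], the random vector X = (X_0,...,X_{n-1}) has law
   N(0, s^2 I_n), i.e. its coordinates are independent N(0, s^2):
   for every Borel rectangle A_0 x ... x A_{n-1},
   P(Y = y, X in prod A_i) = P(Y = y) * prod_i N(0,s^2)(A_i).
   (Rectangles form a pi-system generating the Borel sets of R^n, so this
   determines the conditional law.) *)
Definition cond_gaussian_law {R : realType} {dT : measure_display}
    {T : measurableType dT} (P : probability T R) {n : nat}
    (X : 'I_n -> T -> R) (Y : T -> R) (y s : R) : Prop :=
  forall A : 'I_n -> set R, (forall i, measurable (A i)) ->
    P ([set w | Y w = y] `&` [set w | forall i, A i (X i w)]) =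
    (P [set w | Y w = y] * \prod_(i < n) normal_prob (0:R) s (A i))%E.

(* Main.v *)
(* The linear form <theta, X> of a centred Gaussian vector with independent
   coordinates of standard deviation s is N(0, s^2 |theta|^2): adding one
   coordinate at a time, the product law of the partial sum and the next
   coordinate is determined by its values on rectangles, and the convolution of
   two centred normal densities is computed by completing the square and
   Fubini-Tonelli. The error event is {Y = 1, <theta, X> <= -b} together with
   {Y = -1, <theta, X> >= -b}, which rescaling to N(0, 1) turns into values of
   Phi. The lower bound uses only the second term: p_- >= 1/2 and, by symmetry,
   Phi(x) >= 1/2 for x >= 0. *)
Require Import Defs.
From HB Require Import structures.
From mathcomp Require Import all_boot all_order all_algebra.
From mathcomp Require Import all_classical all_reals all_analysis.
From mathcomp Require Import measurable_realfun.
From mathcomp Require Import ring lra.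
Import Order.TTheory GRing.Theory Num.Theory.
Local Open Scope classical_set_scope.
Local Open Scope ring_scope.
Set Implicit Arguments.
Unset Strict Implicit.
Unset Printing Implicit Defensive.

(** * Affine changes of variable and the normal density *)

Section normal_law.
Context {R : realType}.
Implicit Types (a c m s t x y z : R) (A B : set R).
Local Notation mu := (@lebesgue_measure R).

Definition affine c a : measurableTypeR R -> measurableTypeR R :=
  fun y => c + a * y.

Lemma measurable_affine c a : measurable_fun setT (affine c a).
Proof. by apply: measurable_funD => //; exact: measurable_funM. Qed.

HB.instance Definition _ c a :=
  isMeasurableFun.Build _ _ _ _ (affine c a) (measurable_affine c a).

(** By uniqueness of Lebesgue measure it is enough to compare both sides on intervals []p, q]]. For
    [a < 0] the preimage is closed on the left instead, which leaves its length unchanged. *)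
Lemma lebesgue_measure_affine c a A : a != 0 -> measurable A ->
  (mu A = `|a|%:E * mu (affine c a @^-1` A))%E.
Proof.
move=> a0 mA.
have ocitvE p q :
    (mu `]p, q] = `|a|%:E * mu (affine c a @^-1` `]p, q]%classic))%E.
  have /orP[an|ap] : (a < 0) || (0 < a) by rewrite -neq_lt.
  - rewrite (_ : _ @^-1` _ = `[(q - c) / a, (p - c) / a[%classic); last first.
      apply/seteqP; split => y /=; rewrite !in_itv/= /affine;
      by rewrite ler_ndivrMr// ltr_ndivlMr// => /andP[? ?]; apply/andP; split; lra.
    rewrite !lebesgue_measure_itv/= !lte_fin ltr_nM2r ?invr_lt0// ltrD2r.
    case: ifP => _; last by rewrite mule0.
    rewrite -!EFinD -EFinM ltr0_norm//; congr EFin; field.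
    by rewrite lt_eqF.
  - rewrite (_ : _ @^-1` _ = `](p - c) / a, (q - c) / a]%classic); last first.
      apply/seteqP; split => y /=; rewrite !in_itv/= /affine;
      by rewrite ler_pdivlMr// ltr_pdivrMr// => /andP[? ?]; apply/andP; split; lra.
    rewrite !lebesgue_measure_itv/= !lte_fin ltr_pM2r ?invr_gt0// ltrD2r.
    case: ifP => _; last by rewrite mule0.
    rewrite -!EFinD -EFinM gtr0_norm//; congr EFin; field.
    by rewrite gt_eqF.
apply: (@lebesgue_measure_unique R
  (mscale (NngNum (normr_ge0 a)) (pushforward mu (affine c a)))) => //.
by move=> _ [[p q]] _ <-; exact: ocitvE.
Qed.

(** The Jacobian [|a|] cancels against the peak, and the exponent is invariant. Negative [a * s] is
    harmless, since the density sees only its square. *)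
Lemma normal_pdf_affine c a m s y : a != 0 -> s != 0 ->
  `|a| * normal_pdf (c + a * m) (a * s) (c + a * y) = normal_pdf m s y.
Proof.
move=> a0 s0; rewrite !normal_pdfE ?mulf_neq0// mulrA; congr (_ * _).
  rewrite /normal_peak exprMn -mulrA -mulrnAr sqrtrM ?sqr_ge0// sqrtr_sqr.
  by rewrite invfM mulrA divff ?mul1r// normr_eq0.
by rewrite /normal_fun; congr expR; field; rewrite s0.
Qed.

Lemma normal_prob_affine c a m s B : a != 0 -> s != 0 -> measurable B ->
  normal_prob m s (affine c a @^-1` B) = normal_prob (c + a * m) (a * s) B.
Proof.
move=> a0 s0 mB; rewrite /normal_prob.
set f := fun z => (normal_pdf (c + a * m) (a * s) z)%:E.
have mf : measurable_fun B f.
  by apply/measurable_EFinP/measurable_funTS; exact: measurable_normal_pdf.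
have f0 z : (0 <= f z)%E by rewrite lee_fin normal_pdf_ge0.
have a_ge0 : 0 <= `|a|^-1 by rewrite invr_ge0.
have maf : measurable_fun B (fun z => `|a|%:E * f z)%E.
  exact: emeasurable_funM.
(* The integrand becomes a function of [affine c a y], so the integral can be pushed forward; the
   pushforward of [mu] is [|a|^-1] times [mu]. *)
transitivity (\int[mu]_(y in affine c a @^-1` B)
    ((fun z => `|a|%:E * f z) \o affine c a) y)%E.
  by apply: eq_integral => y _; rewrite /f /= -EFinM normal_pdf_affine.
rewrite -ge0_integral_pushforward//; last first.
  by move=> z _; rewrite mule_ge0.
transitivity (\int[mscale (NngNum a_ge0) mu]_(z in B) (`|a|%:E * f z))%E.
  apply: eq_measure_integral => A mA _.
  rewrite /= /mscale /pushforward.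
  rewrite [X in (_ * X)%E](lebesgue_measure_affine c a0 mA)/= muleA.
  by rewrite -EFinM mulVf ?mul1e// normr_eq0.
rewrite ge0_integral_mscale//; last by move=> z _; rewrite mule_ge0.
by rewrite ge0_integralZl// muleA -EFinM mulVf ?mul1e// normr_eq0.
Qed.

Lemma normal_prob_norm m s B : normal_prob m `|s| B = normal_prob m s B.
Proof.
rewrite /normal_prob; apply: eq_integral => x _; congr EFin.
by rewrite /normal_pdf normr_eq0 /normal_peak /normal_fun real_normK ?num_real.
Qed.

(** The Radon-Nikodym derivative of the normal law agrees almost everywhere with [normal_pdf],
    because the two have equal integrals over every measurable set. *)
Lemma integral_normal_prob m s (f : R -> \bar R) :
  measurable_fun setT f -> (\int[normal_prob m s]_x `|f x| < +oo)%E ->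
  (\int[normal_prob m s]_x f x = \int[mu]_x (f x * (normal_pdf m s x)%:E))%E.
Proof.
move=> mf finf.
rewrite -(Radon_Nikodym_change_of_variables (normal_prob_dominates m s))//=;
  last first.
  by apply/integrableP; split.
apply: ae_eq_integral => //.
- apply: emeasurable_funM => //; apply: (measurable_int mu).
  by apply: Radon_Nikodym_integrable; exact: normal_prob_dominates.
- apply: emeasurable_funM => //=.
  by apply/measurable_EFinP; exact: measurable_normal_pdf.
- apply: ae_eqe_mul2l => /=.
  rewrite Radon_NikodymE//=; first exact: normal_prob_dominates.
  move=> dom; case: cid => /= h [_ h_int hE].
  apply: integral_ae_eq => //=.
  + by apply/measurable_EFinP; exact: measurable_normal_pdf.
  + by move=> E _ mE; rewrite -hE.
Qed.

(* Completing the square in [x]. *)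
Lemma normal_pdfM s t x z : s != 0 -> t != 0 ->
  let r := Num.sqrt (s ^+ 2 + t ^+ 2) in
  normal_pdf x t z * normal_pdf 0 s x =
  normal_pdf 0 r z * normal_pdf (s ^+ 2 * z / r ^+ 2) (s * t / r) x.
Proof.
move=> s0 t0 r.
have s2 : 0 < s ^+ 2 by rewrite exprn_even_gt0.
have t2 : 0 < t ^+ 2 by rewrite exprn_even_gt0.
have rE : r ^+ 2 = s ^+ 2 + t ^+ 2 by rewrite sqr_sqrtr// ltW// addr_gt0.
have r0 : 0 < r by rewrite sqrtr_gt0 addr_gt0.
have rn0 : r != 0 by rewrite gt_eqF.
rewrite !normal_pdfE ?mulf_neq0 ?invr_neq0//.
rewrite ![_ * normal_fun _ _ _ * _]mulrACA; congr (_ * _).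
  (* The peaks match because [t * s = r * (s * t / r)]. *)
  have pi2 := @pi_ge0 R.
  rewrite /normal_peak -!invfM; congr (_^-1).
  rewrite -!sqrtrM ?mulrn_wge0 ?(mulr_ge0 (sqr_ge0 _) pi2)//.
  by congr (Num.sqrt _); field.
rewrite /normal_fun -!expRD; congr expR.
have -> : (s * t / r) ^+ 2 = s ^+ 2 * t ^+ 2 / r ^+ 2 by field.
rewrite rE; field.
by rewrite s0 t0 gt_eqF// addr_gt0.
Qed.

End normal_law.

(** * Sums of independent centred Gaussian variables *)

Section gaussian_sum.
Context {R : realType}.
Implicit Types (a c m s t x y z : R) (A B : set R).
Local Notation mu := (@lebesgue_measure R).

Lemma normal_prob_indic m s B :
  normal_prob m s B = (\int[mu]_z (\1_B z * normal_pdf m s z)%:E)%E.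
Proof.
rewrite /normal_prob integral_mkcond epatch_indic.
by apply: eq_integral => z _ /=; rewrite -EFinM mulrC.
Qed.

Lemma measurable_normal_pdf2 t : t != 0 ->
  measurable_fun [set: measurableTypeR R * measurableTypeR R]
    (fun p => normal_pdf p.1 t p.2 : measurableTypeR R).
Proof.
move=> t0; under eq_fun do rewrite normal_pdfE//.
apply: measurable_funM => //; apply: measurableT_comp => //=.
apply: measurable_funM => //; apply: measurableT_comp => //=.
by apply: measurable_funX => //; exact: measurable_funB.
Qed.

Lemma measurable_indic_normal_pdf t B : t != 0 -> measurable B ->
  measurable_fun [set: measurableTypeR R * measurableTypeR R]
    (fun p => (\1_B p.2 * normal_pdf p.1 t p.2)%:E).
Proof.
move=> t0 mB.
apply/measurable_EFinP/measurable_funM; last exact: measurable_normal_pdf2.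
by apply: measurableT_comp => //; exact: measurable_indic.
Qed.

(** As a function of the mean this is the inner integral of a jointly measurable nonnegative
    function, so Tonelli applies. *)
Lemma measurable_normal_prob t B : t != 0 -> measurable B ->
  measurable_fun setT (fun x => normal_prob x t B).
Proof.
move=> t0 mB; under eq_fun do rewrite normal_prob_indic.
apply: (measurable_fun_fubini_tonelli_F _ (measurable_indic_normal_pdf t0 mB)).
by move=> p; rewrite lee_fin mulr_ge0// normal_pdf_ge0.
Qed.

(** Randomising the mean by N(0, s^2) is convolution: Tonelli moves the integral over the mean
    inside, where [normal_pdfM] applies. *)
Lemma normal_prob_mixture s t B : s != 0 -> t != 0 -> measurable B ->
  (\int[normal_prob 0 s]_x normal_prob x t B =
   normal_prob 0 (Num.sqrt (s ^+ 2 + t ^+ 2)) B)%E.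
Proof.
move=> s0 t0 mB; set r := Num.sqrt _.
have mpdf := @measurable_normal_pdf R.
have pdf0 := @normal_pdf_ge0 R.
have ind0 z : 0 <= \1_B z :> R by [].
have mB1 : measurable_fun setT (\1_B : measurableTypeR R -> R).
  exact: measurable_indic.
have mBt := measurable_indic_normal_pdf t0 mB.
have mN := measurable_normal_prob t0 mB.
rewrite integral_normal_prob//; last first.
  apply: (@le_lt_trans _ _ (\int[normal_prob 0 s]_x cst 1 x)%E).
    apply: ge0_le_integral => //=; first exact: measurableT_comp.
    by move=> x _; rewrite gee0_abs// probability_le1.
  by rewrite integral_cst//= mul1e probability_setT ltry.
transitivity (\int[mu]_x \int[mu]_z
    (\1_B z * normal_pdf x t z * normal_pdf 0 s x)%:E)%E.
  apply: eq_integral => x _; rewrite normal_prob_indic -ge0_integralZr//.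
  - by apply/measurable_EFinP/measurable_funM => //; exact: mpdf.
  - by move=> z _; rewrite lee_fin mulr_ge0.
  - by rewrite lee_fin.
rewrite (fubini_tonelli (fun p : measurableTypeR R * measurableTypeR R =>
  (\1_B p.2 * normal_pdf p.1 t p.2 * normal_pdf 0 s p.1)%:E))//=; last 2 first.
- under eq_fun do rewrite EFinM.
  apply: emeasurable_funM => //; apply/measurable_EFinP.
  exact: (measurableT_comp (mpdf 0 s) measurable_fst).
- by move=> p; rewrite lee_fin !mulr_ge0.
rewrite normal_prob_indic; apply: eq_integral => z _.
(* Only the last factor still depends on [x]; it is a normal density and integrates to 1. *)
under eq_integral do rewrite -mulrA normal_pdfM// mulrA EFinM.
rewrite ge0_integralZl//=.
- by rewrite integral_normal_pdf mule1.
- apply/measurable_EFinP; exact: mpdf.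
- by move=> x _; rewrite lee_fin.
- by rewrite lee_fin mulr_ge0.
Qed.

(* [normal_prob 0 0] is the uniform law on [0, 1], hence the case distinction. *)
Definition gaussian_law s : probability (measurableTypeR R) R :=
  if s == 0 then (\d_(0 : measurableTypeR R) : probability _ _)
  else (normal_prob 0 s : probability _ _).

(** The section at [x] has mass N(x, (c t)^2)(B), to be averaged over [x]. The degenerate cases do
    occur: [c = 0] for a zero coordinate of [theta], [s = 0] for a partial sum that vanishes
    identically. *)
Lemma gaussian_law_sum s t c B : t != 0 -> measurable B ->
  (gaussian_law s \x normal_prob 0 t)%E [set p | B (p.1 + c * p.2)] =
  gaussian_law (Num.sqrt (s ^+ 2 + (c * t) ^+ 2)) B.
Proof.
move=> t0 mB.
rewrite /product_measure1 /=.
have xsE x : xsection [set p | B (p.1 + c * p.2)] x = affine x c @^-1` B.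
  by apply/seteqP; split => y; rewrite /xsection /= inE.
under eq_integral do rewrite /= xsE.
(* For [c = 0] each section is the whole line or empty, so the integrand is the indicator of [B]. *)
have [->|c0] := eqVneq c 0.
  rewrite mul0r expr0n/= addr0 sqrtr_sqr.
  under eq_integral => x _.
    rewrite (_ : _ @^-1` _ = if x \in B then setT else set0); last first.
      rewrite /affine; apply/seteqP; split => y /=; rewrite mul0r addr0.
        by move=> Bx; rewrite mem_set.
      by case: ifPn => // /set_mem.
    rewrite (_ : normal_prob _ _ _ = (\1_B x)%:E); last first.
      rewrite indicE; case: ifPn => _; first by rewrite probability_setT.
      by rewrite measure0.
    over.
  rewrite integral_indic// setIT /gaussian_law normr_eq0.
  by case: ifPn => // _; rewrite /= normal_prob_norm.
have ct0 : c * t != 0 by rewrite mulf_neq0.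
have sum0 : 0 < s ^+ 2 + (c * t) ^+ 2.
  by rewrite ltr_wpDl ?sqr_ge0// exprn_even_gt0.
rewrite {2}/gaussian_law gt_eqF ?sqrtr_gt0//=.
have NE x : normal_prob 0 t (affine x c @^-1` B) = normal_prob x (c * t) B.
  by rewrite normal_prob_affine// mulr0 addr0.
rewrite /gaussian_law; have [->|s0] := eqVneq s 0; last first.
  by under eq_integral do rewrite NE; rewrite normal_prob_mixture.
(* For [s = 0] the Dirac mass evaluates the integrand at mean 0. *)
rewrite integral_dirac//; last first.
  by under eq_fun do rewrite NE; exact: measurable_normal_prob.
by rewrite diracT mul1e NE expr0n/= add0r sqrtr_sqr normal_prob_norm.
Qed.

End gaussian_sum.

Lemma norm2_gt0 (R : realType) n (u : 'I_n -> R) :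
  (exists i, u i != 0) -> 0 < norm2 u.
Proof.
move=> [i0 u0]; rewrite sqrtr_gt0 (bigD1 i0)//= ltr_pwDl ?exprn_even_gt0//.
by apply: sumr_ge0 => i _; exact: sqr_ge0.
Qed.

(** * The law of a linear form of X on the event Y = y *)

Section conditional_law_of_linear_form.
Context {R : realType} {dT : measure_display} {T : measurableType dT}.
Variables (P : probability T R) (n : nat) (X : 'I_n -> T -> R) (Y : T -> R).
Variables (y s : R) (theta : 'I_n -> R).
Hypotheses (mX : forall i, measurable_fun [set: T] (X i)).
Hypotheses (mY : measurable_fun [set: T] Y).
Hypotheses (s0 : 0 < s) (XY : cond_gaussian_law P X Y y s).

(** Filtering the index set, rather than shortening it, keeps the index type ['I_n] fixed during the
    induction on [k]. *)
Let S k w := \sum_(i < n | (i < k)%N) theta i * X i w.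
Let v k := \sum_(i < n | (i < k)%N) theta i ^+ 2.

Let mS k : measurable_fun [set: T] (S k).
Proof.
rewrite /S; under eq_fun do rewrite big_mkcond.
apply: measurable_sum => i; case: (i < k)%N => //; exact: measurable_funM.
Qed.

Let mYy : measurable [set w | Y w = y].
Proof.
rewrite (_ : [set _ | _] = Y @^-1` [set y]) // -[X in measurable X]setTI.
exact: mY.
Qed.

Let mcyl k (A : 'I_n -> set R) : (forall i, measurable (A i)) ->
  measurable [set w | forall i : 'I_n, (k <= i)%N -> A i (X i w)].
Proof.
move=> mA.
rewrite (_ : [set _ | _] =
    \bigcap_(i in [set i : 'I_n | (k <= i)%N]) (X i @^-1` A i)).
  apply: fin_bigcap_measurable; first exact: finite_finset.
  by move=> i _; rewrite -[X in measurable X]setTI; exact: mX.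
by apply/seteqP; split => w /=.
Qed.

(** Induction on [k]. The constraints on the coordinates not yet summed stay in the statement, so
    that the next coordinate can be split off as independent of the partial sum. *)
Let cond_partial_sum k (A : 'I_n -> set R) (B : set R) : (k <= n)%N ->
  (forall i, measurable (A i)) -> measurable B ->
  (P ([set w | Y w = y] `&` (S k @^-1` B `&`
      [set w | forall i : 'I_n, (k <= i)%N -> A i (X i w)])) =
   P [set w | Y w = y] * gaussian_law (s * Num.sqrt (v k)) B *
   \prod_(i < n | (k <= i)%N) normal_prob (0 : R) s (A i))%E.
Proof.
have N_fin (A' : 'I_n -> set R) (Q : pred 'I_n) :
    (forall i, measurable (A' i)) ->
    (\prod_(i < n | Q i) normal_prob (0 : R) s (A' i))%E \is a fin_num.
  move=> mA'; apply: (big_ind (fun x => x \is a fin_num)) => //.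
    by move=> a b; exact: fin_numM.
  by move=> i _; apply: (fin_num_measure (normal_prob 0 s)); exact: mA'.
elim: k A B => [|k IH] A B kn mA mB.
  (* The empty sum has law [gaussian_law 0], the Dirac mass at 0: the claim is the hypothesis [XY]
     if 0 lies in [B], and both sides vanish otherwise. *)
  have v0 : v 0 = 0 by rewrite /v big_pred0.
  have S0 w : S 0 w = 0 by rewrite /S big_pred0.
  rewrite v0 sqrtr0 mulr0 /gaussian_law eqxx/=.
  rewrite diracE; have [/set_mem B0|B0] := boolP (_ \in B).
    rewrite mule1 -XY//; congr (P (_ `&` _)).
    apply/seteqP; split => w /=; first by move=> [_ h] i; exact: h.
    by move=> h; split; first rewrite S0.
  rewrite mule0 mul0e (_ : _ `&` _ = set0) ?measure0//.
  apply/seteqP; split => w //= [_ [+ _]].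
  by rewrite S0 => /mem_set; rewrite (negbTE B0).
pose i0 := Ordinal kn.
have Sk w : S k.+1 w = S k w + theta i0 * X i0 w.
  rewrite /S (bigD1 i0)//= addrC; congr (_ + _); apply: eq_bigl => i.
  by rewrite ltnS -val_eqE/= [RHS]ltn_neqAle andbC.
have vk : v k.+1 = v k + theta i0 ^+ 2.
  rewrite /v (bigD1 i0)//= addrC; congr (_ + _); apply: eq_bigl => i.
  by rewrite ltnS -val_eqE/= [RHS]ltn_neqAle andbC.
have prodk A' : (\prod_(i < n | (k <= i)%N) normal_prob (0 : R) s (A' i) =
   normal_prob (0 : R) s (A' i0) *
   \prod_(i < n | (k < i)%N) normal_prob (0 : R) s (A' i))%E.
  rewrite (bigD1 i0)//=; congr (_ * _)%E; apply: eq_bigl => i.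
  by rewrite -val_eqE/= [RHS]ltn_neqAle eq_sym andbC.
set E := [set w | Y w = y] `&`
  [set w | forall i : 'I_n, (k < i)%N -> A i (X i w)].
have mE : measurable E by apply: measurableI => //; exact: mcyl.
pose h w : measurableTypeR R * measurableTypeR R := (S k w, X i0 w).
have mh : measurable_fun setT h.
  by apply: measurable_fun_pair; [exact: mS|exact: mX].
(* The mass of [E] under [P], used below as an unnormalised scale factor. *)
set p := (P [set w | Y w = y] *
  \prod_(i < n | (k < i)%N) normal_prob 0 s (A i))%E.
have p_fin : p \is a fin_num by rewrite fin_numM ?N_fin// fin_num_measure.
have p_ge0 : 0 <= fine p.
  by apply: fine_ge0; rewrite mule_ge0// prode_ge0.
pose g := gaussian_law (s * Num.sqrt (v k)).
pose C := [set q : measurableTypeR R * measurableTypeR R |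
  B (q.1 + theta i0 * q.2)].
have mC : measurable C.
  pose f (q : measurableTypeR R * measurableTypeR R) : measurableTypeR R :=
    q.1 + theta i0 * q.2.
  have mf : measurable_fun setT f.
    by apply: measurable_funD => //; exact: measurable_funM.
  by rewrite (_ : C = f @^-1` B)// -[X in measurable X]setTI; exact: mf.
(* Restricted to [E], the pair [h] has law [p] times a product measure. Agreement on rectangles
   suffices, and it comes from the induction hypothesis with [A2] placed at index [k]. *)
have joint : (mscale (NngNum p_ge0) g \x normal_prob (0 : R) s)%E C =
    pushforward (mrestr P mE) h C.
  apply: product_measure_unique => // A1 A2 mA1 mA2.
  pose A' (i : 'I_n) : set R := if i == i0 then A2 else A i.
  have mA' i : measurable (A' i) by rewrite /A'; case: ifP => _ //; exact: mA.
  have A'E (i : 'I_n) : (k < i)%N -> A' i = A i.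
    by move=> ki; rewrite /A' -val_eqE/= gtn_eqF.
  transitivity (P ([set w | Y w = y] `&` (S k @^-1` A1 `&`
      [set w | forall i : 'I_n, (k <= i)%N -> A' i (X i w)]))).
    rewrite /pushforward /mrestr; congr (P _).
    apply/seteqP; split => w /=.
    - move=> [[SA XA] [Yw Aw]]; split => //; split => // i.
      rewrite leq_eqVlt => /orP[/eqP ki|ki]; last by rewrite A'E//; exact: Aw.
      by have -> : i = i0 by [exact: val_inj]; rewrite /A' eqxx.
    - move=> [Yw [SA Aw]]; split; first split => //.
        by have := Aw i0 (leqnn _); rewrite /A' eqxx.
      by split => // i ki; rewrite -A'E//; apply: Aw; exact: ltnW.
  rewrite IH ?(ltnW kn)// prodk {1}/A' eqxx.
  under eq_bigr => i ki do rewrite A'E//.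
  rewrite [RHS](_ : _ = p * g A1 * normal_prob 0 s A2)%E; last first.
    by congr (_ * _)%E; rewrite /= /mscale/= fineK.
  rewrite /p -/g.
  rewrite -!muleA; congr (_ * _)%E.
  by rewrite [LHS]muleA [LHS]muleC.
transitivity (pushforward (mrestr P mE) h C).
  rewrite /pushforward /mrestr; congr (P _).
  by apply/seteqP; split => w /=; rewrite /E /C /h /= Sk; tauto.
rewrite -joint.
transitivity ((fine p)%:E * (g \x normal_prob (0 : R) s)%E C)%E.
  rewrite /product_measure1 ge0_integral_mscale//.
  exact: measurable_fun_xsection.
rewrite gaussian_law_sum ?gt_eqF// fineK//.
(* Variances add: s^2 v_k + (theta_k s)^2 = s^2 v_(k+1). *)
rewrite (_ : Num.sqrt _ = s * Num.sqrt (v k.+1)); last first.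
  have vk0 : 0 <= v k by apply: sumr_ge0 => i _; exact: sqr_ge0.
  rewrite vk -[X in _ = X * _](gtr0_norm s0) -sqrtr_sqr -sqrtrM ?sqr_ge0//.
  by rewrite 2!exprMn sqr_sqrtr//; congr (Num.sqrt _); ring.
by rewrite /p muleAC.
Qed.

(** The case [k = n] of the induction; a nonzero [theta] excludes the Dirac branch of
    [gaussian_law]. *)
Lemma cond_gaussian_law_inner (B : set R) :
  (exists i, theta i != 0) -> measurable B ->
  (P ([set w | Y w = y] `&` [set w | B (inner theta (fun i => X i w))]) =
   P [set w | Y w = y] * normal_prob (0 : R) (s * norm2 theta) B)%E.
Proof.
move=> theta0 mB.
have := @cond_partial_sum n (fun=> setT) B (leqnn n) (fun=> measurableT) mB.
rewrite [X in (_ * X)%E]big_pred0 ?mule1; last first.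
  by move=> i; rewrite leqNgt ltn_ord.
have -> : v n = \sum_(i < n) theta i ^+ 2.
  by apply: eq_bigl => i; rewrite ltn_ord.
rewrite -/(norm2 theta).
rewrite /gaussian_law gt_eqF ?mulr_gt0 ?norm2_gt0//= => <-; congr (P (_ `&` _)).
have SE w : S n w = inner theta (fun i => X i w).
  by apply: eq_bigl => i; rewrite ltn_ord.
by apply/seteqP; split => w /=; rewrite SE => // -[].
Qed.

End conditional_law_of_linear_form.

(** * Scaling and symmetry of the standard normal distribution function *)

Section standard_normal_cdf.
Context {R : realType}.
Implicit Types t x : R.

Lemma PhiE x : (Phi x)%:E = normal_prob (0 : R) 1 `]-oo, x].
Proof. by rewrite /Phi fineK// fin_num_measure. Qed.

Lemma normal_prob_scale t (B : set R) : t != 0 -> measurable B ->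
  normal_prob 0 t B = normal_prob 0 1 (affine 0 t @^-1` B).
Proof.
by move=> t0 mB; rewrite normal_prob_affine ?oner_neq0// mulr0 addr0 mulr1.
Qed.

Lemma normal_prob_itvNy t x : 0 < t ->
  normal_prob 0 t `]-oo, x] = (Phi (x / t))%:E.
Proof.
move=> t0; rewrite normal_prob_scale ?gt_eqF// PhiE; congr normal_prob.
by apply/seteqP; split => y /=;
  rewrite !in_itv/= /affine add0r ler_pdivlMr// mulrC.
Qed.

Lemma normal_prob_itvy t x : 0 < t ->
  normal_prob 0 t `[- x, +oo[ = (Phi (x / t))%:E.
Proof.
(* Replacing [t] by [- t] leaves the law unchanged, and rescaling by [- t] reflects the upper ray
   onto a lower one. *)
move=> t0; rewrite -normal_prob_norm -normrN normal_prob_norm.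
rewrite normal_prob_scale ?oppr_eq0 ?gt_eqF// PhiE; congr normal_prob.
by apply/seteqP; split => y /=;
  rewrite !in_itv/= andbT /affine add0r ler_pdivlMr// mulNr lerN2 mulrC.
Qed.

Lemma Phi_ge0 x : 0 <= Phi x.
Proof. exact/fine_ge0. Qed.

(** For [x >= 0] the rays up to [x] and from [- x] cover the line, and each has mass [Phi x]. *)
Lemma Phi_ge_half x : 0 <= x -> 1 / 2 <= Phi x.
Proof.
move=> x0.
have lower := normal_prob_itvNy x (@ltr01 R).
have upper := normal_prob_itvy x (@ltr01 R).
have : (normal_prob (0 : R) 1 setT <=
    normal_prob (0 : R) 1 `]-oo, x] + normal_prob (0 : R) 1 `[(- x)%R, +oo[)%E.
  rewrite (_ : setT = `]-oo, x]%classic `|` `[- x, +oo[%classic).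
    exact: measureU2.
  apply/seteqP; split => y //= _; rewrite !in_itv/= andbT.
  by have [yx|yx] := leP y x; [left|right]; lra.
rewrite lower upper probability_setT divr1 -EFinD lee_fin; lra.
Qed.

End standard_normal_cdf.

(** * The error probability of the linear classifier and its lower bound *)

Theorem theorem2 (R : realType) (dT : measure_display) (T : measurableType dT)
    (P : probability T R) (n : nat) (X : 'I_n -> T -> R) (Y : T -> R)
    (sigma1 beta pplus : R) (theta : 'I_n -> R) (b : R) :
  (0 < n)%N -> 0 < sigma1 -> 3 < beta -> 0 < pplus < 1 -> 1 / 2 <= 1 - pplus ->
  (forall i, measurable_fun [set: T] (X i)) -> measurable_fun [set: T] Y ->
  (forall w, Y w = 1 \/ Y w = -1) ->
  P [set w | Y w = 1] = pplus%:E ->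
  P [set w | Y w = -1] = (1 - pplus)%:E ->
  cond_gaussian_law P X Y 1 sigma1 ->
  cond_gaussian_law P X Y (-1) (Num.sqrt beta * sigma1) ->
  (exists i, theta i != 0) -> 0 < b ->
  let err := pplus * Phi (- (b / (norm2 theta * sigma1)))
             + (1 - pplus) * Phi (b / (norm2 theta * Num.sqrt beta * sigma1)) in
  P [set w | Num.sg (inner theta (fun i => X i w) + b) != Y w] = err%:E
  /\ 1 / 4 <= err.
Proof.
move=> _ sigma0 beta3 /andP[p0 p1] phalf mX mY Ypm PY1 PYN1 XY1 XYN1.
move=> theta0 b0 err.
have beta0 : 0 < Num.sqrt beta by rewrite sqrtr_gt0; lra.
have norm0 : 0 < norm2 theta by exact: norm2_gt0.
split; last first.
  have : 1 / 2 <= Phi (b / (norm2 theta * Num.sqrt beta * sigma1)).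
    by apply: Phi_ge_half; rewrite divr_ge0 ?mulr_ge0 ?ltW.
  have := Phi_ge0 (- (b / (norm2 theta * sigma1))).
  rewrite /err; nra.
pose S w := inner theta (fun i => X i w).
have mS : measurable_fun setT S.
  by apply: measurable_sum => i; exact: measurable_funM.
have mpre (f : T -> R) (B : set R) : measurable_fun setT f -> measurable B ->
    measurable (f @^-1` B).
  by move=> mf mB; rewrite -[X in measurable X]setTI; exact: mf.
have mY1 y : measurable [set w | Y w = y].
  exact: (mpre _ [set y] mY (measurable_set1 y)).
(* Both rays are closed: at [S w = - b] the value [Num.sg 0 = 0] differs from either label and
   counts as an error. *)
rewrite (_ : [set _ | _] =
    ([set w | Y w = 1] `&` [set w | `]-oo, (- b)]%classic (S w)]) `|`
    ([set w | Y w = -1] `&` [set w | `[(- b), +oo[%classic (S w)])); last first.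
  apply/seteqP; split => w /=; rewrite -/(S w) !in_itv/= andbT.
  - case: (Ypm w) => Yw; rewrite Yw => sgN; [left|right]; split => //.
      rewrite leNgt; apply/negP => Sb; move: sgN.
      by rewrite gtr0_sg ?eqxx//; lra.
    rewrite leNgt; apply/negP => Sb; move: sgN.
    by rewrite ltr0_sg ?eqxx//; lra.
  - case=> -[-> Sb].
      apply/eqP => /eqP; rewrite sgr_cp0 => ?; lra.
    apply/eqP => /eqP; rewrite sgr_cp0 => ?; lra.
rewrite measureU//; last first.
- apply/seteqP; split => w //= -[[-> _] [Yw _]]; lra.
- by apply: measurableI => //; exact: mpre.
- by apply: measurableI => //; exact: mpre.
have sigma'0 : 0 < Num.sqrt beta * sigma1 by rewrite mulr_gt0.
have S1 := cond_gaussian_law_inner mX mY sigma0 XY1 theta0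
  (measurable_itv `]-oo, (- b)]).
have SN1 := cond_gaussian_law_inner mX mY sigma'0 XYN1 theta0
  (measurable_itv `[(- b), +oo[).
etransitivity; first exact: (congr2 +%E S1 SN1).
rewrite PY1 PYN1 normal_prob_itvNy ?mulr_gt0// normal_prob_itvy ?mulr_gt0//.
rewrite -!EFinM -EFinD /err mulNr.
congr (_ * Phi (- (_ / _)) + _ * Phi (_ / _))%:E.
  by rewrite mulrC.
by ring.
Qed.
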